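(* For every prime $p$ and all integers $n\ge 0$, $r,s,k\ge 1$, $t,u,\ell\ge 0$ and $j$ with $1\le j<p$, we have \[\bar{b}^{p^2k+p\ell}_{p^2r+pt,\;p^2s+pu}(p^2n+pj)\equiv 0\pmod{p}.\]
   Context: Write $f_m=\prod_{i\ge 1}(1-q^{mi})$ for $m\ge 1$, and $f_m^a$ for its $a$-th power. For integers $r,s,k\ge 1$, $\bar{b}^k_{r,s}(n)$ denotes the number of overcolored partition $k$-tuples of $n$: $k$-tuples of partitions of total weight $n$ in which each even part may appear in one of $r$ colors, each odd part may appear in one of $s$ colors, and the first occurrence of each part (of each color) in each component may be overlined. Equivalently, as formal power series in $q$, \[\sum_{n=0}^{\infty}\bar{b}^k_{r,s}(n)q^n=\frac{f_2^{(3s-2r)k}}{f_1^{2sk}f_4^{(s-r)k}}.\] (The superscript is the number of components of the tuple, not a power.) *)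

(* Defs.v *)
From mathcomp Require Import all_boot.

Set Implicit Arguments.
Unset Strict Implicit.
Unset Printing Implicit Defensive.

Definition ncolors (r s i : nat) : nat := if odd i then s else r.

(* Colored parts of size at most n: the element (i, c) is the part of size
   i.+1 with color c. *)
Definition cpart (r s n : nat) : finType :=
  {i : 'I_n & 'I_(ncolors r s i.+1)}.

Definition part_size (r s n : nat) (x : cpart r s n) : nat := (tag x).+1.

(* A partition into colored parts: each colored part x is mapped to its
   multiplicity (0 if x does not occur) and to a flag telling whether the first
   occurrence of x is overlined.  Bounding part sizes and multiplicities by n
   loses nothing, since only total weight n is counted below. *)
Definition flagged_partition (r s n : nat) : finType :=
  {ffun cpart r s n -> 'I_n.+1 * bool}.

Definition weight (r s n : nat) (lam : flagged_partition r s n) : nat :=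
  \sum_(x : cpart r s n) (lam x).1 * part_size x.

(* Only a part that occurs can be overlined; this also makes the encoding
   injective. *)
Definition overcolored (r s n : nat) (lam : flagged_partition r s n) : bool :=
  [forall x : cpart r s n, (lam x).2 ==> (0 < (lam x).1)].

Definition bbar (k r s n : nat) : nat :=
  #|[set T : {ffun 'I_k -> flagged_partition r s n} |
      [forall i, overcolored (T i)] && (\sum_(i < k) weight (T i) == n)]|.

(* Main.v *)
(** In characteristic [p], the [p ^ 2]-th power of a power series is a series in
   [q ^ (p ^ 2)].  When [p] divides the number of components and both numbers of
   colors, the generating function, a product of one factor per component and
   colored part, is such a power, whereas [p ^ 2] does not divide
   [p ^ 2 * n + p * j]. *)
Require Import Defs.
From mathcomp Require Import all_boot.
From mathcomp Require Import all_algebra zify.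

Import GRing.Theory.

(** Frobenius is additive on [{poly R}], so [P ^+ p] is the sum of the [p]-th powers of the
    monomials of [P]. *)
Lemma coef_pchar_expr (R : comNzRingType) (p : nat) (pcharRp : p \in [pchar R]%R)
    (P : {poly R}) (i : nat) :
  ((P ^+ p)`_i = if (p %| i)%N then P`_(i %/ p)%N ^+ p else 0)%R.
Proof.
have p_gt0 : 0 < p by case/andP: pcharRp => /prime_gt0.
have pcharPp : p \in [pchar {poly R}]%R by rewrite pchar_poly.
rewrite -[P in LHS]coefK poly_def -(pFrobenius_autE pcharPp) rmorph_sum /=.
under eq_bigr do rewrite pFrobenius_autE exprZn -exprM.
rewrite coef_sum; under eq_bigr do rewrite coefZ coefXn.
case: ifP => [/dvdnP [m ->] | pNi]; last first.
  apply: big1 => m _; case: eqP => [i_def|]; last by rewrite mulr0.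
  by rewrite i_def dvdn_mull in pNi.
rewrite mulnK //; case: (ltnP m (size P)) => [lt_m | le_m].
  rewrite (bigD1 (Ordinal lt_m)) //= eqxx mulr1 big1 ?addr0 // => c /eqP ne_cm.
  rewrite eqn_pmul2r //; case: eqP => [eq_mc|]; last by rewrite mulr0.
  by case: ne_cm; apply/val_inj.
rewrite nth_default // expr0n eqn0Ngt p_gt0; apply: big1 => c _.
by rewrite eqn_pmul2r // gtn_eqF ?mulr0 // (leq_trans (ltn_ord c)).
Qed.

(* [v] is the multiplicity and overline flag of a single colored part of size
   [m]. *)
Definition part_gf (R : nzRingType) (n m : nat) : {poly R} :=
  (\sum_(v : 'I_n.+1 * bool | v.2 ==> (0 < v.1)%N) 'X^(v.1 * m)%N)%R.

(** Expanding the product chooses a multiplicity and a flag for each colored part; [overcolored]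
    constrains each choice separately. *)
Lemma flagged_partition_gf (R : comNzRingType) (r s n : nat) :
  (\sum_(lam : flagged_partition r s n | overcolored lam) 'X^(weight lam)
   = \prod_(i < n) part_gf R n i.+1 ^+ ncolors r s i.+1)%R.
Proof.
under [RHS]eq_bigr => i _ do rewrite -[X in (_ ^+ X)%R]card_ord -prodr_const.
rewrite (sig_big_dep _ _ (fun (i : 'I_n) (_ : 'I_(ncolors r s i.+1)) =>
  part_gf R n i.+1)) /=.
rewrite bigA_distr_big /=; apply: eq_big => [lam|lam _].
  by apply/forallP/ffun_onP.
by rewrite /weight -prodrXr.
Qed.

Lemma bbar_coef (R : comNzRingType) (k r s n : nat) :
  ((bbar k r s n)%:R
   = ((\prod_(i < n) part_gf R n i.+1 ^+ ncolors r s i.+1) ^+ k)`_n)%R.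
Proof.
rewrite -flagged_partition_gf -[k in RHS]card_ord -prodr_const bigA_distr_big /=.
rewrite coef_sum /bbar -sum1_card natr_sum.
under [RHS]eq_bigr do rewrite prodrXr coefXn eq_sym mulrb.
rewrite -big_mkcondr /=; apply: eq_bigl => T; rewrite inE.
by congr (_ && _); apply/forallP/ffun_onP.
Qed.

Theorem theorem1p10 (p : nat) (hp : prime p) (n r s k t u l j : nat)
  (hr : 1 <= r) (hs : 1 <= s) (hk : 1 <= k) (hj : 1 <= j < p) :
  bbar (p ^ 2 * k + p * l) (p ^ 2 * r + p * t) (p ^ 2 * s + p * u)
       (p ^ 2 * n + p * j) = 0 %[mod p].
Proof.
have pcharFp := pchar_Fp hp.
have comps_dvd : p ^ 2 * k + p * l = (p * k + l) * p by nia.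
have colors_dvd m : ncolors (p ^ 2 * r + p * t) (p ^ 2 * s + p * u) m
                    = ncolors (p * r + t) (p * s + u) m * p.
  by rewrite /ncolors; case: ifP => _; nia.
have weight_dvd : p ^ 2 * n + p * j = (p * n + j) * p by nia.
apply/eqP; rewrite mod0n -/(dvdn _ _) (dvdn_pcharf pcharFp) bbar_coef comps_dvd.
under eq_bigr do rewrite colors_dvd exprM.
(* One factor [p] comes from the colors, one from the components; together they give a [p]-th power
   of a [p]-th power. *)
rewrite prodrXl -exprM mulnCA !exprM !(coef_pchar_expr _ _ pcharFp) weight_dvd.
(* The first division by [p] leaves the index [p * n + j], which [p] does not divide as
   [0 < j < p]. *)
rewrite dvdn_mull // mulnK ?prime_gt0 //.
case/andP: hj => j_gt0 ltjp; rewrite dvdn_addr ?dvdn_mulr //.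
by rewrite gtnNdvd // expr0n gtn_eqF ?prime_gt0.
Qed.
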